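(* Let $n\ge 2$ and $q\in[0,1)$. Let $c^q_{i,j}(n)$ be the probability, in the stationary distribution of the multispecies PASEP of type $\langle 1^n\rangle=(1,\ldots,1)$ on the ring with $n$ sites, that the particle labeled $i$ is at the first site and the particle labeled $j$ is at the second site, and let $c^0_{i,j}(n)$ be the same probability for $q=0$. For $1\le j<i\le n$, \begin{align*} c_{i,j}^q(n) = c_{i,j}^0(n) &+\frac{(i-j+1)\,(2j(n-i)+i+j-n-1)\,([i-j+1]_q-1)}{n^2(n-1)[i-j+1]_q}\\ &-\frac{(i-j+2)(j-1)(n-i)([i-j+2]_q-1)}{n^2(n-1)[i-j+2]_q}-\frac{j(i-j)(n-i+1)([i-j]_q-1)}{n^2(n-1)[i-j]_q}, \end{align*} and for $1\le i<j\le n$, \begin{align*} c_{i,j}^q(n) = c_{i,j}^0(n)&-\frac{(j-i+1)\,(2i(n-j)+i+j-n-1)\,q^{j-i}}{n^2(n-1)[j-i+1]_q}\\ &+\frac{(i-1)(j-i+2)(n-j)\,q^{j-i+1}}{n^2(n-1)[j-i+2]_q}+\varepsilon_{i,j}, \end{align*} where $\varepsilon_{i,j}=\dfrac{i(j-i)(n-j+1)\,q^{j-i-1}}{n^2(n-1)[j-i]_q}$ if $i<j-1$, and $\varepsilon_{i,j}=0$ if $i=j-1$.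
   Context: For an integer $k>0$, $[k]_q=1+q+\cdots+q^{k-1}$. The multispecies PASEP of type $\langle 1^n\rangle=(1,\ldots,1)$ is the continuous-time Markov chain whose states are the words $\omega=(\omega_1,\ldots,\omega_n)$ that are permutations of $\{1,\ldots,n\}$; $\omega_k$ is the label of the particle at site $k$ of the ring $\mathbb{Z}_n$ (site $n$ is followed by site $1$). For each pair of cyclically consecutive sites $(k,k+1)$, if the particle at the left site $k$ has label $i$ and the particle at the right site $k+1$ has label $j$, the two particles exchange places ($ij\to ji$) with rate $1$ if $i>j$ and with rate $q$ if $i<j$. The chain has a unique stationary distribution. The values at $q=0$ are known (Ayyer and Linusson): $c^0_{i,j}(n)=\frac{i-j}{n\binom n2}$ if $i>j$; $c^0_{i,j}(n)=\frac1{n^2}+\frac{i(n-i)}{n^2(n-1)}$ if $i=j-1$; $c^0_{i,j}(n)=\frac1{n^2}$ if $i<j-1$. *)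

(* Defs.v *)
From HB Require Import structures.
From mathcomp Require Import all_boot all_order all_algebra all_fingroup.
Set Implicit Arguments.
Unset Strict Implicit.
Unset Printing Implicit Defensive.
Import Order.TTheory GRing.Theory Num.Theory.
Local Open Scope ring_scope.

Definition qint (R : realFieldType) (q : R) (k : nat) : R :=
  \sum_(m < k) q ^+ m.

(* A word of type <1^n> is a permutation of 'I_n; site k of the ring Z_n is the
   ordinal k - 1, and ordinals are shifted by one to get labels in {1, .., n}. *)
Definition label (n : nat) (w : {perm 'I_n}) (k : 'I_n) : nat := (w k).+1.

(* Permutations compose left to right: the result maps x to w (tperm k (ordS k) x). *)
Definition exchange (n : nat) (w : {perm 'I_n}) (k : 'I_n) : {perm 'I_n} :=
  (tperm k (ordS k) * w)%g.

Definition exchange_rate (R : realFieldType) (q : R) (i j : nat) : R :=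
  if (j < i)%N then 1 else if (i < j)%N then q else 0.

Definition jump_rate (R : realFieldType) (n : nat) (q : R)
    (w w' : {perm 'I_n}) : R :=
  \sum_(k : 'I_n | exchange w k == w')
     exchange_rate q (label w k) (label w (ordS k)).

Definition generator (R : realFieldType) (n : nat) (q : R)
    (w w' : {perm 'I_n}) : R :=
  if w == w' then - \sum_(v | v != w) jump_rate q w v else jump_rate q w w'.

Definition stationary (R : realFieldType) (n : nat) (q : R)
    (mu : {ffun {perm 'I_n} -> R}) : Prop :=
  [/\ forall w, 0 <= mu w,
      \sum_w mu w = 1
    & forall w', \sum_w mu w * generator q w w' = 0].

Definition two_point (R : realFieldType) (n : nat) (hn : (1 < n)%N)
    (mu : {ffun {perm 'I_n} -> R}) (i j : nat) : R :=
  \sum_(w | (label w (Ordinal (ltnW hn)) == i) && (label w (Ordinal hn) == j))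
     mu w.

(* Main.v *)
Require Import Defs.
From HB Require Import structures.
From mathcomp Require Import all_boot all_order all_algebra all_fingroup.
From mathcomp Require Import ring lra zify.
Set Implicit Arguments.
Unset Strict Implicit.
Unset Printing Implicit Defensive.
Import Order.TTheory GRing.Theory Num.Theory.
Local Open Scope ring_scope.

(* Merging the labels <= s, those in (s, t] and those > t gives a chain on words
   in three letters 0, 1, 2, whose number k = t - s of letters 1 is the only
   parameter entering nontrivially. For k = 0 its stationary measure is uniform.
   For k > 0 it is given by a matrix product Tr X_(w_1) .. X_(w_n) with
   X_0 = 1 + e, X_1 = A, X_2 = 1 + d acting on the q-oscillator
   e|j> = |j+1>, d|j> = (1 - q^j)|j-1>, A|j> = q^j|j>, so that
   X_0 X_2 = X_0 + X_2 - A and X_2 X_0 = X_0 + X_2 - q A. These two relations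
   express the weights of 02 and 20 at the first two sites through partition
   functions of size n - 1, and the partition function is
   Z(n, s, m) = C(n, s) C(n, m) / (1 - q^k), m = n - t, because merging the letters
   1 and 2 must yield the uniform measure. The numbers c_(i,j) are the mixed second
   differences in (s, t) of the two-point functions so obtained. *)

(** * Uniqueness of stationary measures *)

(** Stationarity tested against functions: the generator applied to any g has mean zero. Transitions
    are indexed by moves rather than by targets, and mu may be signed because uniqueness is proved
    through differences. *)
Definition weakly_stationary (R : realFieldType) (T K : finType)
    (move : T -> K -> T) (rate : T -> K -> R) (mu : T -> R) : Prop :=
  forall g : T -> R,
    \sum_x mu x * \sum_k rate x k * (g (move x k) - g x) = 0.

Section Uniqueness.

Variables (R : realFieldType) (T K : finType).
Variables (move : T -> K -> T) (rate : T -> K -> R).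
Hypothesis rate_ge0 : forall x k, 0 <= rate x k.

Let inflow (mu : T -> R) (y : T) : R :=
  \sum_x mu x * \sum_k rate x k * (move x k == y)%:R.
Let outrate (x : T) : R := \sum_k rate x k.
Let balanced (mu : T -> R) : Prop := forall y, inflow mu y = mu y * outrate y.

Let balanced_of_weakly_stationary mu :
  weakly_stationary move rate mu -> balanced mu.
Proof.
move=> mu_st y; apply/eqP; rewrite -subr_eq0; apply/eqP.
rewrite -[RHS](mu_st (fun x => (x == y)%:R)) /inflow.
have -> : mu y * outrate y = \sum_x mu x * (outrate x * (x == y)%:R).
  rewrite (bigD1 y) //= eqxx mulr1 big1 ?addr0 // => x /negPf ->.
  by rewrite !mulr0.
rewrite -sumrB; apply: eq_bigr => x _; rewrite -mulrBr; congr (_ * _).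
rewrite /outrate mulr_suml -sumrB; apply: eq_bigr => k _.
by rewrite mulrBr.
Qed.

Let sum_inflow mu : \sum_y inflow mu y = \sum_x mu x * outrate x.
Proof.
rewrite /inflow exchange_big /=; apply: eq_bigr => x _.
rewrite -mulr_sumr exchange_big /=; congr (_ * _); apply: eq_bigr => k _.
rewrite -mulr_sumr (bigD1 (move x k)) //= eqxx big1 ?addr0 ?mulr1 // => y.
by rewrite eq_sym => /negPf ->.
Qed.

Let inflow_coef_ge0 x y : 0 <= \sum_k rate x k * (move x k == y)%:R.
Proof. by apply: sumr_ge0 => k _; rewrite mulr_ge0 ?ler0n. Qed.

(** By the triangle inequality, outflow is at most inflow for |mu| at every point; the totals agree
    by [sum_inflow], so equality holds everywhere. *)
Let balanced_norm mu : balanced mu -> balanced (fun x => `|mu x|).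
Proof.
move=> mu_bal.
have le_in y : `|mu y| * outrate y <= inflow (fun x => `|mu x|) y.
  have out_ge0 : 0 <= outrate y by apply: sumr_ge0.
  rewrite -[outrate y]ger0_norm // -normrM -mu_bal /inflow.
  apply: le_trans (ler_norm_sum _ _ _) _; apply: ler_sum => x _.
  by rewrite normrM [`|\sum_k _|]ger0_norm.
have /eqP := sum_inflow (fun x => `|mu x|).
rewrite -subr_eq0 -sumrB psumr_eq0 => [/allP eq_in y|y _].
  have /implyP/(_ isT) := eq_in y (mem_index_enum y).
  by rewrite subr_eq0 => /eqP.
by rewrite subr_ge0.
Qed.

Let balancedD mu nu : balanced mu -> balanced nu ->
  balanced (fun x => mu x + nu x).
Proof.
move=> mu_bal nu_bal y; rewrite mulrDl -mu_bal -nu_bal -big_split /=.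
by apply: eq_bigr => x _; rewrite mulrDl.
Qed.

Let balancedN mu : balanced mu -> balanced (fun x => - mu x).
Proof.
move=> mu_bal y; rewrite mulNr -mu_bal -sumrN.
by apply: eq_bigr => x _; rewrite mulNr.
Qed.

(** If mu vanished at the target, so would the inflow there, a sum of nonnegative terms that
    contains a positive one coming from x. *)
Let balanced_support_closed mu x k : balanced mu -> (forall x, 0 <= mu x) ->
  mu x != 0 -> 0 < rate x k -> mu (move x k) != 0.
Proof.
move=> mu_bal mu_ge0 mux rxk; apply/eqP => mu0.
have /eqP := mu_bal (move x k); rewrite mu0 mul0r psumr_eq0; last first.
  by move=> z _; rewrite mulr_ge0.
move=> /allP/(_ x (mem_index_enum x))/implyP/(_ isT).
rewrite mulf_eq0 (negPf mux) /= psumr_eq0; last first.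
  by move=> l _; rewrite mulr_ge0 ?ler0n.
move=> /allP/(_ k (mem_index_enum k))/implyP/(_ isT).
by rewrite eqxx mulr1 gt_eqF.
Qed.

(* The positive and negative parts of a signed stationary measure are again
   stationary, so their supports are closed under the dynamics; being disjoint,
   they cannot both contain x0. *)
Lemma weakly_stationary_eq0 (D : pred T) (x0 : T) (mu : T -> R) :
  (forall C : pred T, (forall x, C x -> D x) ->
     (forall x k, C x -> 0 < rate x k -> C (move x k)) ->
     forall x, C x -> C x0) ->
  weakly_stationary move rate mu -> (forall x, mu x != 0 -> D x) ->
  \sum_x mu x = 0 -> forall x, mu x = 0.
Proof.
move=> reach /balanced_of_weakly_stationary mu_bal muD mu_sum0.
have abs_bal := balanced_norm mu_bal.
have pos_bal := balancedD abs_bal mu_bal.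
have neg_bal := balancedD abs_bal (balancedN mu_bal).
have pos_ge0 x : 0 <= `|mu x| + mu x.
  by have := ler_norm (- mu x); rewrite normrN; lra.
have neg_ge0 x : 0 <= `|mu x| + - mu x by have := ler_norm (mu x); lra.
have mu_nz x : `|mu x| + mu x != 0 \/ `|mu x| + - mu x != 0 -> D x.
  move=> H; apply: muD; apply/eqP => mux0.
  by case: H; rewrite mux0 normr0 ?oppr0 addr0 eqxx.
have pos_x0 := reach (fun x => `|mu x| + mu x != 0)
  (fun x H => mu_nz x (or_introl H))
  (fun x k => balanced_support_closed pos_bal pos_ge0).
have neg_x0 := reach (fun x => `|mu x| + - mu x != 0)
  (fun x H => mu_nz x (or_intror H))
  (fun x k => balanced_support_closed neg_bal neg_ge0).
have [/existsP[y /pos_x0 pos0]|] := boolP [exists y, `|mu y| + mu y != 0].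
  have neg0 z : `|mu z| + - mu z = 0.
    apply/eqP; apply: contraT => /neg_x0 neg0.
    by move: pos0 neg0; case: (ler0P (mu x0)) => _; rewrite ?subrr ?addNr ?addrN eqxx.
  have mu_ge0 z : 0 <= mu z by have := neg0 z; have := normr_ge0 (mu z); lra.
  move=> x; apply/eqP.
  move/eqP: mu_sum0; rewrite psumr_eq0 // => /allP/(_ x (mem_index_enum x)).
  by move/implyP; apply.
rewrite negb_exists => /forallP pos0.
have mu_le0 y : 0 <= - mu y.
  have := pos0 y; rewrite negbK => /eqP.
  by have := normr_ge0 (mu y); lra.
have/eqP : \sum_x - mu x = 0 by rewrite sumrN mu_sum0 oppr0.
move=> mu_sum x; apply/eqP.
move: mu_sum; rewrite psumr_eq0 // => /allP/(_ x (mem_index_enum x)).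
by rewrite oppr_eq0; move/implyP; apply.
Qed.

(** The combination (sum nu) mu - (sum mu) nu is stationary of total mass zero, hence vanishes. *)
Lemma weakly_stationary_proportional (D : pred T) (x0 : T) (mu nu : T -> R) :
  (forall C : pred T, (forall x, C x -> D x) ->
     (forall x k, C x -> 0 < rate x k -> C (move x k)) ->
     forall x, C x -> C x0) ->
  weakly_stationary move rate mu -> (forall x, mu x != 0 -> D x) ->
  weakly_stationary move rate nu -> (forall x, nu x != 0 -> D x) ->
  forall x, (\sum_y nu y) * mu x = (\sum_y mu y) * nu x.
Proof.
move=> reach mu_st muD nu_st nuD x; apply/eqP; rewrite -subr_eq0; apply/eqP.
pose rho z := (\sum_y nu y) * mu z - (\sum_y mu y) * nu z.
apply: (weakly_stationary_eq0 (mu := rho) reach) => [g|z|].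
- rewrite /rho; under eq_bigr do rewrite mulrBl -!mulrA.
  by rewrite sumrB -!mulr_sumr mu_st nu_st !mulr0 subrr.
- have [mu0|/muD //] := eqVneq (mu z) 0.
  have [nu0|/nuD //] := eqVneq (nu z) 0.
  by rewrite /rho mu0 nu0 !mulr0 subrr eqxx.
- by rewrite /rho sumrB -!mulr_sumr mulrC subrr.
Qed.

End Uniqueness.

(** Use the test function g o p. Rates may disagree on a move that fixes the image, since its
    increment is zero. *)
Lemma weakly_stationary_lump (R : realFieldType) (T U K : finType)
    (move : T -> K -> T) (rate : T -> K -> R)
    (move' : U -> K -> U) (rate' : U -> K -> R) (p : T -> U) (mu : T -> R) :
  (forall x k, p (move x k) = move' (p x) k) ->
  (forall x k, rate x k = rate' (p x) k \/ move' (p x) k = p x) ->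
  weakly_stationary move rate mu ->
  weakly_stationary move' rate' (fun u => \sum_(x | p x == u) mu x).
Proof.
move=> move_p rate_p mu_st g.
rewrite -[RHS](mu_st (g \o p)).
under eq_bigr do rewrite mulr_suml.
rewrite (exchange_big_dep xpredT) //=; apply: eq_bigr => x _.
rewrite (big_pred1 (p x)) => [|u]; last by rewrite eq_sym.
congr (_ * _); apply: eq_bigr => k _.
rewrite move_p.
by case: (rate_p x k) => -> //; rewrite subrr !mulr0.
Qed.

(** * Matrix product weights *)

Notation L0 := (@Ordinal 3 0 isT).
Notation L1 := (@Ordinal 3 1 isT).
Notation L2 := (@Ordinal 3 2 isT).

(* Tr (e^a A^c d^a); for c = 0, where the trace diverges, this is 0 since 0^-1 = 0. *)
Fixpoint normal_trace (R : realFieldType) (q : R) (a c : nat) : R :=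
  if a is a'.+1 then
    (1 - q ^+ a) / (1 - q ^+ (a + c)) * normal_trace q a' c
  else (1 - q ^+ c)^-1.

Definition trace0 (R : realFieldType) (q : R) (c a b : nat) : R :=
  if a == b then normal_trace q a c else 0.

(* A function h c a b stands for a linear functional h on the span of the normally
   ordered monomials N = e^a A^c d^b; right_mul x h is N |-> h (N X_x) and
   left_mul x h is N |-> h (X_x N), normally ordered by de = q ed + 1 - q,
   dA = q Ad and Ae = q eA. *)
Definition right_mul (R : realFieldType) (q : R) (x : 'I_3)
    (h : nat -> nat -> nat -> R) (c a b : nat) : R :=
  match val x with
  | 0 => h c a b + q ^+ (b + c) * h c a.+1 b + (1 - q ^+ b) * h c a b.-1
  | 1 => q ^+ b * h c.+1 a b
  | _ => h c a b + h c a b.+1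
  end.

Definition left_mul (R : realFieldType) (q : R) (x : 'I_3)
    (h : nat -> nat -> nat -> R) (c a b : nat) : R :=
  match val x with
  | 0 => h c a b + h c a.+1 b
  | 1 => q ^+ a * h c.+1 a b
  | _ => h c a b + q ^+ (a + c) * h c a b.+1 + (1 - q ^+ a) * h c a.-1 b
  end.

(** The functional N |-> Tr (N X_(w_1) .. X_(w_n)); [weight] is its value at N = 1. *)
Definition word_functional (R : realFieldType) (q : R) (w : seq 'I_3) :
  nat -> nat -> nat -> R := foldr (right_mul q) (trace0 q) w.

Definition weight (R : realFieldType) (q : R) (w : seq 'I_3) : R :=
  word_functional q w 0 0 0.

Lemma letterP (P : 'I_3 -> Prop) : P L0 -> P L1 -> P L2 -> forall x, P x.
Proof.
move=> P0 P1 P2 [[|[|[|//]]] lt_x]; [move: P0|move: P1|move: P2];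
  by congr P; apply: val_inj.
Qed.

Section Weight.

Variables (R : realFieldType) (q : R).
Hypotheses (hq0 : 0 <= q) (hq1 : q < 1).

Let qpow_neq1 k : (0 < k)%N -> 1 - q ^+ k != 0.
Proof.
case: k => // k _; rewrite subr_eq0 eq_sym lt_eqF //.
by rewrite exprn_ilt1.
Qed.

(** Associativity: both sides are N |-> h (X_x N X_y). *)
Let left_right_mulC x y h c a b :
  left_mul q x (right_mul q y h) c a b = right_mul q y (left_mul q x h) c a b.
Proof.
elim/letterP: x; elim/letterP: y; rewrite /left_mul /right_mul /=;
  case: a => [|a]; case: b => [|b] /=;
  rewrite ?addSn ?addnS ?add0n ?addn0 ?exprS ?exprD ?expr0; ring.
Qed.

Let normal_traceS a c : normal_trace q a.+1 c * (1 - q ^+ (a.+1 + c)) =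
  (1 - q ^+ a.+1) * normal_trace q a c.
Proof. by rewrite /= mulrAC divfK // qpow_neq1. Qed.

(** At c = 0 the right side is 0 by the default value of the trace while the left side is not, hence
    the condition on c. *)
Let normal_trace_cS a c : (0 < c)%N ->
  normal_trace q a c.+1 * (1 - q ^+ (a.+1 + c)) =
  normal_trace q a c * (1 - q ^+ c).
Proof.
move=> c_gt0; elim: a => [|a IHa].
  by rewrite /= add1n !mulVf ?qpow_neq1.
have D_neq0 : 1 - q ^+ (a.+1 + c) != 0 by apply: qpow_neq1.
apply: (mulIf D_neq0); have -> : (a.+2 + c = a.+1 + c.+1)%N by rewrite addSnnS.
by rewrite normal_traceS -mulrA IHa [RHS]mulrAC normal_traceS mulrA.
Qed.

(** Cyclicity of the trace, Tr (N X_x) = Tr (X_x N), on normally ordered monomials N. *)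
Let trace_left_right x c a b :
  right_mul q x (trace0 q) c a b = left_mul q x (trace0 q) c a b.
Proof.
elim/letterP: x; rewrite /left_mul /right_mul /= /trace0.
- case: b => [|b]; first by rewrite expr0 subrr mul0r addr0 mulr0 addr0.
  rewrite eqSS succnK; case: (eqVneq a b) => [<-|_]; last by rewrite !mulr0 !addr0.
  have := normal_traceS a c; lra.
- by case: eqVneq => [->|_]; rewrite ?mulr0.
- case: a => [|a].
    by rewrite expr0 subrr mul0r addr0; case: b => [|b]; rewrite /= ?mulr0 ?addr0.
  rewrite eqSS succnK; case: (eqVneq a b) => [->|_]; last by rewrite !mulr0 !addr0.
  have := normal_traceS b c; lra.
Qed.

Let left_mul_foldr x w h c a b :
  left_mul q x (foldr (right_mul q) h w) c a b =
  foldr (right_mul q) (left_mul q x h) w c a b.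
Proof.
elim: w c a b => [//|y w IHw] c a b /=; rewrite left_right_mulC.
by rewrite /right_mul !IHw.
Qed.

Let eq_foldr_right_mul w g h :
  (forall c a b, g c a b = h c a b) -> forall c a b,
  foldr (right_mul q) g w c a b = foldr (right_mul q) h w c a b.
Proof.
move=> eq_gh; elim: w => [//|y w IHw] c a b /=.
by rewrite /right_mul !IHw.
Qed.

(** Cyclicity turns the last letter into a left multiplication, which commutes past the other
    letters; at N = 1 left and right multiplication agree. *)
Lemma weight_rcons x w : weight q (rcons w x) = weight q (x :: w).
Proof.
rewrite /weight /word_functional -cats1 foldr_cat /=.
rewrite (eq_foldr_right_mul _ (trace_left_right x)) -left_mul_foldr.
by elim/letterP: x; rewrite /left_mul /right_mul /= !expr0; ring.
Qed.

(* e^(a+1) A^c d^(b+1) = q^-c e^a A^c (ed) d^b, where ed = 1 - A. *)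
Let word_functional_ed w c a b : (0 < c + count_mem L1 w)%N ->
  q ^+ c * word_functional q w c a.+1 b.+1 =
  word_functional q w c a b - word_functional q w c.+1 a b.
Proof.
elim: w c a b => [|x w IHw] c a b.
  rewrite addn0 => c_gt0; rewrite /word_functional /= /trace0 eqSS.
  case: eqP => [_|_]; last by rewrite mulr0 subr0.
  have D_neq0 : 1 - q ^+ (a.+1 + c) != 0 by apply: qpow_neq1.
  apply: (mulIf D_neq0); rewrite -mulrA normal_traceS [RHS]mulrBl.
  by rewrite normal_trace_cS // exprD; ring.
elim/letterP: x => /= gt0; rewrite /word_functional /= -/(word_functional q w)
  /right_mul /=.
- have Ka := IHw c a b gt0.
  have Ka1 := congr1 ( *%R (q ^+ b.+1 * q ^+ c)) (IHw c a.+1 b gt0).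
  (* For b = 0 the value at [b.-1] is a default, harmless because 1 - q^0 = 0. *)
  have Kb : (1 - q ^+ b) * (q ^+ c * word_functional q w c a.+1 b) =
      (1 - q ^+ b) * (word_functional q w c a b.-1 -
                      word_functional q w c.+1 a b.-1).
    by case: b {Ka Ka1} => [|b]; rewrite ?expr0 ?subrr ?mul0r // IHw.
  move: Ka Ka1 Kb; rewrite !addnS !addSn ?exprS !exprD; lra.
(* A letter 1 passes into the exponent c, which keeps the sum of c and the number of letters 1
   positive. *)
- have := IHw c.+1 a b; rewrite addSnnS => /(_ gt0)/(congr1 ( *%R (q ^+ b))).
  rewrite !exprS; lra.
- by have := IHw c a b gt0; have := IHw c a b.+1 gt0; lra.
Qed.

(** X_0 X_2 = 1 + e + d + ed with ed = 1 - A. The letter 1 in w makes the traces convergent. *)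
Lemma weight_02 w : (0 < count_mem L1 w)%N ->
  weight q [:: L0, L2 & w] =
  weight q (L0 :: w) + weight q (L2 :: w) - weight q (L1 :: w).
Proof.
move=> w1; have := word_functional_ed 0 0 (w1 : 0 < 0 + _)%N.
rewrite /weight /word_functional /= -/(word_functional q w) /right_mul /=.
rewrite expr0; lra.
Qed.

(** X_2 X_0 = 1 + e + d + de with de = q ed + 1 - q = 1 - q A. *)
Lemma weight_20 w : (0 < count_mem L1 w)%N ->
  weight q [:: L2, L0 & w] =
  weight q (L0 :: w) + weight q (L2 :: w) - q * weight q (L1 :: w).
Proof.
move=> w1; have := word_functional_ed 0 0 (w1 : 0 < 0 + _)%N.
rewrite /weight /word_functional /= -/(word_functional q w) /right_mul /=.
by move/(congr1 ( *%R q)); rewrite !addn0 !expr0 !expr1; lra.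
Qed.

(** From A e = q e A; the next relation comes from d A = q A d in the same way. *)
Lemma weight_10 w : weight q [:: L1, L0 & w] =
  q * weight q [:: L0, L1 & w] + (1 - q) * weight q (L1 :: w).
Proof.
rewrite /weight /word_functional /= -/(word_functional q w) /right_mul /=.
rewrite add0n expr0 expr1; ring.
Qed.

Lemma weight_21 w : weight q [:: L2, L1 & w] =
  q * weight q [:: L1, L2 & w] + (1 - q) * weight q (L1 :: w).
Proof.
rewrite /weight /word_functional /= -/(word_functional q w) /right_mul /=.
rewrite expr0 expr1; ring.
Qed.

(** No e occurs, so only the terms free of d survive in the trace: each X_2 contributes 1, and Tr
    A^c = 1 / (1 - q^c). This starts the recursion for the partition function. *)
Lemma weight_no0 w : L0 \notin w ->
  weight q w = (1 - q ^+ count_mem L1 w)^-1.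
Proof.
suff H c b : L0 \notin w -> word_functional q w c 0 b =
    if b == 0%N then (1 - q ^+ (c + count_mem L1 w))^-1 else 0.
  by move=> w0; rewrite /weight H.
elim: w c b => [|x w IHw] c b.
  by rewrite /word_functional /= /trace0 eq_sym addn0.
rewrite /word_functional /= -/(word_functional q w) /right_mul.
elim/letterP: x => //=; rewrite inE /= => w0; rewrite !IHw //.
- by case: b => [|b]; rewrite ?mulr0 // expr0 mul1r add1n addSnnS.
- by rewrite addr0.
Qed.

End Weight.

(** * The exchange dynamics on words in three letters *)

Definition swap (n : nat) (v : n.-tuple 'I_3) (k : 'I_n) : n.-tuple 'I_3 :=
  [tuple tnth v (tperm k (ordS k) i) | i < n].

Definition bond_rate (R : realFieldType) (q : R) (n : nat)
    (v : n.-tuple 'I_3) (k : 'I_n) : R :=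
  exchange_rate q (tnth v k) (tnth v (ordS k)).

Definition content (s m : nat) (w : seq 'I_3) : bool :=
  (count_mem L0 w == s) && (count_mem L2 w == m).

Lemma count_letters (w : seq 'I_3) :
  (count_mem L0 w + count_mem L1 w + count_mem L2 w)%N = size w.
Proof. by elim: w => //= x w <-; elim/letterP: x => /=; lia. Qed.

Lemma swapK n (k : 'I_n) : involutive (fun v => swap v k).
Proof. by move=> v; apply: eq_from_tnth => i; rewrite !tnth_mktuple tpermK. Qed.

Lemma perm_swap n (v : n.-tuple 'I_3) k : perm_eq (swap v k) v.
Proof. by apply/tuple_permP; exists (tperm k (ordS k)). Qed.

Lemma content_swap n s m (v : n.-tuple 'I_3) k :
  content s m (swap v k) = content s m v.
Proof. by rewrite /content !(seq.permP (perm_swap v k)). Qed.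

Lemma content_perm_eq s m (v w : seq 'I_3) : size v = size w ->
  content s m v -> content s m w -> perm_eq v w.
Proof.
move=> eq_sz /andP[/eqP v0 /eqP v2] /andP[/eqP w0 /eqP w2].
have := count_letters v; have := count_letters w.
rewrite v0 v2 w0 w2 eq_sz => <- /addIn/addnI w1.
apply/allP => x _; apply/eqP; rewrite /=.
by elim/letterP: x; rewrite ?v0 ?v2 ?w0 ?w2.
Qed.

Lemma bond_rate_swap (R : realFieldType) (q : R) n (v : n.-tuple 'I_3) k :
  bond_rate q (swap v k) k = exchange_rate q (tnth v (ordS k)) (tnth v k).
Proof. by rewrite /bond_rate !tnth_mktuple tpermL tpermR. Qed.

Lemma exchange_rate_ge0 (R : realFieldType) (q : R) i j :
  0 <= q -> 0 <= exchange_rate q i j.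
Proof. by rewrite /exchange_rate; do 2!case: ifP => _ //. Qed.

Definition position_sum n (v : n.-tuple 'I_3) : nat :=
  \sum_(i < n) i * tnth v i.

Lemma position_sum_swap n (v : n.-tuple 'I_3) (k : 'I_n) : (k.+1 < n)%N ->
  (tnth v (ordS k) < tnth v k)%N -> (position_sum v < position_sum (swap v k))%N.
Proof.
move=> lt_kn lt_v; have valS : ordS k = k.+1 :> nat by rewrite /= modn_small.
have neq : ordS k != k by rewrite -val_eqE [val (ordS k)]valS gtn_eqF.
rewrite /position_sum (bigD1 k) //= (bigD1 (ordS k)) //=.
rewrite [ltnRHS](bigD1 k) //= [X in (_ < _ + X)%N](bigD1 (ordS k)) //=.
rewrite !tnth_mktuple tpermL tpermR modn_small //.
rewrite [X in (_ < _ + (_ + X))%N](eq_bigr (fun i : 'I_n => (i * tnth v i)%N)).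
  move: lt_v; set x := tnth v (ordS k); set y := tnth v k.
  move: (\sum_(_ | _) _)%N => z lt_v; nia.
by move=> i /andP[ik iSk]; rewrite tnth_mktuple tpermD // eq_sym.
Qed.

(* Bubble sort: descents are exchanged at rate 1 whatever q is, and each such exchange
   raises position_sum, so a word of C maximizing it is sorted. *)
Lemma swap_reach (R : realFieldType) (q : R) n (x0 : n.-tuple 'I_3)
    (C : pred (n.-tuple 'I_3)) :
  sorted leq (map val x0) -> (forall v, C v -> perm_eq v x0) ->
  (forall v k, C v -> 0 < bond_rate q v k -> C (swap v k)) ->
  forall v, C v -> C x0.
Proof.
move=> x0_sorted C_x0 C_swap v Cv.
have [w Cw w_max] := @arg_maxnP _ v C (@position_sum n) Cv.
suff /val_inj <- : val w = x0 by [].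
apply: (inj_map val_inj).
apply: (sorted_eq leq_trans anti_leq) => //; last exact: perm_map (C_x0 _ Cw).
apply/(sortedP 0) => i; rewrite size_map size_tuple => lt_in.
pose k : 'I_n := Ordinal (ltnW lt_in).
have valS : ordS k = i.+1 :> nat by rewrite /= modn_small.
rewrite !(nth_map L0) ?size_tuple //; last exact: ltnW.
suff : (tnth w k <= tnth w (ordS k))%N by rewrite !(tnth_nth L0) valS.
rewrite leqNgt; apply/negP => lt_w.
have /w_max : C (swap w k).
  by apply: C_swap => //; rewrite /bond_rate /exchange_rate lt_w.
by rewrite /geq /= leqNgt position_sum_swap.
Qed.

(** By sorting, every word of the given content reaches the same sorted word, so uniqueness
    applies. *)
Lemma words_proportional (R : realFieldType) (q : R) n s m
    (mu nu : n.-tuple 'I_3 -> R) : 0 <= q ->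
  weakly_stationary (@swap n) (@bond_rate R q n) mu ->
  (forall v, mu v != 0 -> content s m v) ->
  weakly_stationary (@swap n) (@bond_rate R q n) nu ->
  (forall v, nu v != 0 -> content s m v) ->
  forall v, (\sum_w nu w) * mu v = (\sum_w mu w) * nu v.
Proof.
move=> q_ge0 mu_st mu_ct nu_st nu_ct v.
have [/existsP[y y_ct]|none] := boolP [exists y : n.-tuple 'I_3, content s m y]; last first.
  have z0 (rho : n.-tuple 'I_3 -> R) :
      (forall v, rho v != 0 -> content s m v) -> rho v = 0.
    move=> ct; apply/eqP; apply: contraT => /ct v_ct.
    by case/existsP: none; exists v.
  by rewrite !z0 // !mulr0.
pose x0 := sort_tuple (fun x y : 'I_3 => (x <= y)%N) y.
have rate_ge0 u k : 0 <= bond_rate q (u : n.-tuple 'I_3) k.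
  exact: exchange_rate_ge0.
refine (@weakly_stationary_proportional R _ _ _ _ rate_ge0
  (fun w : n.-tuple 'I_3 => content s m w) x0 mu nu _ mu_st mu_ct nu_st nu_ct v).
move=> C C_ct C_swap w Cw.
apply: (swap_reach (q := q)) Cw => // [|u /C_ct u_ct].
  by rewrite sorted_map; apply: sort_sorted => a b; apply: leq_total.
rewrite perm_sym (perm_trans (permEl (perm_sort _ _))) //.
by apply: content_perm_eq y_ct u_ct; rewrite !size_tuple.
Qed.

(** Bond by bond, the gain term is reindexed by the involution [swap]; this turns the pairing with g
    into the net flow into each word. *)
Lemma balance_weakly_stationary (R : realFieldType) (q : R) n
    (mu : n.-tuple 'I_3 -> R) :
  (forall v, \sum_k (mu (swap v k) * exchange_rate q (tnth v (ordS k)) (tnth v k)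
     - mu v * exchange_rate q (tnth v k) (tnth v (ordS k))) = 0) ->
  weakly_stationary (@swap n) (@bond_rate R q n) mu.
Proof.
move=> bal g.
transitivity (\sum_v g v *
    \sum_k (mu (swap v k) * exchange_rate q (tnth v (ordS k)) (tnth v k)
     - mu v * exchange_rate q (tnth v k) (tnth v (ordS k)))); last first.
  by apply: big1 => v _; rewrite bal mulr0.
have -> : \sum_v mu v * (\sum_k bond_rate q v k * (g (swap v k) - g v)) =
    \sum_k (\sum_v mu v * bond_rate q v k * g (swap v k)
            - \sum_v mu v * bond_rate q v k * g v).
  under eq_bigr do rewrite mulr_sumr.
  rewrite exchange_big; apply: eq_bigr => k _; rewrite -sumrB.
  by apply: eq_bigr => v _; rewrite -mulrBr mulrA.
under [RHS]eq_bigr do rewrite mulr_sumr.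
rewrite [RHS]exchange_big; apply: eq_bigr => k _.
rewrite (reindex_inj (inv_inj (swapK k))) -sumrB; apply: eq_bigr => v _.
by rewrite swapK bond_rate_swap /bond_rate; ring.
Qed.

Lemma tnth_rot1 n (v : n.-tuple 'I_3) i :
  tnth [tuple of rot 1 v] i = tnth v (ordS i).
Proof.
rewrite !(tnth_nth L0) /=; case: n v i => [|n] v i; first by case: i.
case/tupleP: v => x v; rewrite /= rot1_cons nth_rcons size_tuple.
case: (ltngtP i n) (ltn_ord i) => [lt_in|lt_ni|->] _; rewrite ?modnn //.
  by rewrite modn_small.
by move/ltnSE: (ltn_ord i); lia.
Qed.

Lemma swap_rot1 n (v : n.-tuple 'I_3) k :
  [tuple of rot 1 (swap v (ordS k))] = swap [tuple of rot 1 v] k.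
Proof.
apply: eq_from_tnth => i; rewrite tnth_rot1 !tnth_mktuple tnth_rot1.
congr tnth; case: tpermP => [/(@ordS_inj n) ->|/(@ordS_inj n) ->|].
- by rewrite tpermL.
- by rewrite tpermR.
by move=> ik iSk; rewrite tpermD //; apply/eqP => E; [apply: ik|apply: iSk]; rewrite E.
Qed.

Lemma swap_ord0 n (v : n.+2.-tuple 'I_3) x y z : v = [:: x, y & z] :> seq _ ->
  swap v ord0 = [:: y, x & z] :> seq _.
Proof.
move=> vE; have sz_z : size z = n by have := size_tuple v; rewrite vE => -[].
apply: (@eq_from_nth _ L0) => [|i]; rewrite size_tuple //= ?sz_z // => lt_i.
transitivity (tnth (swap v ord0) (Ordinal lt_i)); first by rewrite (tnth_nth L0).
rewrite tnth_mktuple (tnth_nth L0) vE.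
case: tpermP => [/(congr1 val) /= ->|/(congr1 val) /= ->|] //=.
case: i lt_i => [|[|i]] //= lt_i; first by case; apply: val_inj.
by move=> _ []; apply: val_inj.
Qed.

(** * Stationarity of the matrix product measure and of the uniform measure *)

Section WeightStationary.

Variables (R : realFieldType) (q : R).
Hypotheses (hq0 : 0 <= q) (hq1 : q < 1).

(* The net flow into v across the bond (k, k + 1) is 1 - q times
   sign (v_k) weight (v without v_k) - sign (v_(k+1)) weight (v without v_(k+1)),
   which telescopes around the ring. *)
Definition letter_sign (x : 'I_3) : R := (x == L0)%:R - (x == L2)%:R.

Definition deletion_weight (v : seq 'I_3) : R :=
  letter_sign (head L0 v) * weight q (behead v).

Let net_flow n (v : n.-tuple 'I_3) (k : 'I_n) : R :=
  weight q (swap v k) * exchange_rate q (tnth v (ordS k)) (tnth v k)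
  - weight q v * exchange_rate q (tnth v k) (tnth v (ordS k)).

Let weight_rot1 w : weight q (rot 1 w) = weight q w.
Proof. by case: w => [//|x w]; rewrite rot1_cons (weight_rcons hq0 hq1). Qed.

(** Equal leading letters give 0 on both sides; the mixed pairs are the quadratic relations, where
    for 02 and 20 the letter 1 lies in the rest of the word. *)
Let net_flow0 n (v : n.+2.-tuple 'I_3) : (0 < count_mem L1 v)%N ->
  net_flow v ord0 =
  (1 - q) * (deletion_weight v - deletion_weight (rot 1 v)).
Proof.
case/tupleP: v => x v; case/tupleP: v => y z.
rewrite /net_flow (@swap_ord0 n _ x y z) //.
have -> : rot 1 [tuple of x :: [tuple of y :: z]] = y :: rcons z x.
  by apply: rot1_cons.
rewrite /deletion_weight !(tnth_nth L0) /= (weight_rcons hq0 hq1).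
rewrite /letter_sign.
elim/letterP: x; elim/letterP: y => /=; rewrite ?add0n ?add1n => z1;
  rewrite /exchange_rate /= ?weight_10 ?weight_21 ?weight_02 ?weight_20 //; ring.
Qed.

Let net_flowE n (v : n.+2.-tuple 'I_3) k : (0 < count_mem L1 v)%N ->
  net_flow v k =
  (1 - q) * (deletion_weight (rot k v) - deletion_weight (rot k.+1 v)).
Proof.
case: k => k lt_k; elim: k v lt_k => [|k IHk] v lt_k v1.
  by rewrite rot0 -net_flow0 //; congr net_flow; apply: val_inj.
pose k' := Ordinal (ltnW lt_k).
have -> : Ordinal lt_k = ordS k'.
  by apply: val_inj; rewrite /= modn_small.
have v1' : (0 < count_mem L1 [tuple of rot 1 v])%N.
  by rewrite /= (seq.permP (permEl (perm_rot 1 v))).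
have := IHk [tuple of rot 1 v] (ltnW lt_k) v1'; rewrite -/k' /=.
have rotS j : (j < n.+2)%N -> rot j (rot 1 v) = rot j.+1 v.
  by move=> lt_j; rewrite -rotD ?addn1 // size_tuple.
rewrite rotS ?(ltnW lt_k) // rotS // modn_small // => <-.
by rewrite /net_flow -swap_rot1 !tnth_rot1 /= !weight_rot1.
Qed.

Lemma weight_weakly_stationary n s m : (s + m < n.+2)%N ->
  weakly_stationary (@swap n.+2) (@bond_rate R q n.+2)
    (fun v => if content s m v then weight q v else 0).
Proof.
move=> lt_sm; apply: balance_weakly_stationary => v.
under eq_bigr do rewrite content_swap.
have [v_ct|_] := ifPn; last by apply: big1 => k _; rewrite !mul0r subrr.
have v1 : (0 < count_mem L1 v)%N.
  by have := count_letters v; case/andP: v_ct => /eqP-> /eqP->; rewrite size_tuple; lia.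
rewrite (eq_bigr _ (fun k _ => net_flowE k v1)) -mulr_sumr.
(* The telescoping sum closes up because rotation by the full length is the identity. *)
have -> : \sum_(k < n.+2) (deletion_weight (rot k v) - deletion_weight (rot k.+1 v)) = 0.
  rewrite -(big_mkord xpredT
    (fun k => deletion_weight (rot k v) - deletion_weight (rot k.+1 v))).
  rewrite (telescope_sumr_eq (fun k => - deletion_weight (rot k v))) // => [|k _].
    by rewrite rot0 rot_oversize ?size_tuple // subrr.
  by rewrite opprK addrC.
by rewrite mulr0.
Qed.

(** Without letters 1, the net flow over a bond is 1 - q times the increment of the indicator of
    letter 2, and increments cancel around the ring. *)
Lemma uniform_weakly_stationary n s m : (s + m = n)%N ->
  weakly_stationary (@swap n) (@bond_rate R q n)
    (fun v => (content s m v)%:R).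
Proof.
move=> eq_sm; apply: balance_weakly_stationary => v.
under eq_bigr do rewrite content_swap -mulrBr.
rewrite -mulr_sumr; have [v_ct|_] := boolP (content s m v); last by rewrite mul0r.
have v1 : L1 \notin v.
  apply/count_memPn.
  have := count_letters v; case/andP: v_ct => /eqP-> /eqP->; rewrite size_tuple.
  by move=> E; apply: (@addnI (s + m)); rewrite addnAC in E; rewrite E addn0.
have vi1 i : tnth v i != L1 by apply: contraNneq v1 => <-; apply: mem_tnth.
rewrite mul1r (eq_bigr (fun k => (1 - q) *
    ((tnth v (ordS k) == L2)%:R - (tnth v k == L2)%:R))) => [|k _].
  rewrite -mulr_sumr sumrB [X in _ * (X - _)](_ : _ = \sum_k (tnth v k == L2)%:R).
    by rewrite subrr mulr0.
  by rewrite [RHS](reindex_inj (@ordS_inj n)).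
move: (vi1 k) (vi1 (ordS k)).
by elim/letterP: (tnth v k); elim/letterP: (tnth v (ordS k)) => // _ _;
  rewrite /exchange_rate /=; ring.
Qed.

End WeightStationary.

(** * Sums over words with given content *)

Section WordSums.

Variable R : realFieldType.
Implicit Types (F : seq 'I_3 -> R) (P : pred (seq 'I_3)).

Definition word_sum (n s m : nat) F : R :=
  \sum_(v : n.-tuple 'I_3 | content s m v) F v.

Definition word_sum2 (n s m : nat) (x y : 'I_3) F : R :=
  \sum_(v : n.-tuple 'I_3 |
    [&& nth L1 v 0 == x, nth L1 v 1 == y & content s m v]) F v.

Lemma sum_head n P F x :
  \sum_(v : n.+1.-tuple 'I_3 | (nth L1 v 0 == x) && P v) F v =
  \sum_(u : n.-tuple 'I_3 | P (x :: u)) F (x :: u).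
Proof.
rewrite (reindex_onto (fun u : n.-tuple 'I_3 => [tuple of x :: u])
                      (fun v => [tuple of behead v])) /=.
  apply: eq_bigl => u; rewrite eqxx /= -[_ && (_ == u)]andbC.
  by rewrite (_ : _ == u = true) //; apply/eqP; apply: val_inj.
move=> v /andP[/eqP <- _]; apply: val_inj; rewrite /=.
by case/tupleP: v.
Qed.

Lemma word_sum2E n s m x y F :
  word_sum2 n.+2 s m x y F =
  \sum_(u : n.-tuple 'I_3 | content s m [:: x, y & u]) F [:: x, y & u].
Proof.
rewrite /word_sum2 (sum_head _ (fun v => (nth L1 v 1 == y) && content s m v)).
exact: (sum_head _ (fun v => content s m (x :: v)) (fun v => F (x :: v))).
Qed.

(** By rotation invariance the sum over words with x at position i does not depend on i; adding over
    i counts the letters x in each word. *)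
Lemma word_sum_head n s m x F : (forall w, F (rot 1 w) = F w) ->
  n.+1%:R * \sum_(u : n.-tuple 'I_3 | content s m (x :: u)) F (x :: u) =
  \sum_(v : n.+1.-tuple 'I_3 | content s m v) (count_mem x v)%:R * F v.
Proof.
move=> F_rot; rewrite -(sum_head _ (content s m)).
pose S i := \sum_(v : n.+1.-tuple 'I_3 | (nth L1 v i == x) && content s m v) F v.
rewrite -/(S 0%N).
have S_const i : (i < n.+1)%N -> S i = S 0%N.
  elim: i => // i IHi lt_i; rewrite -IHi ?(ltnW lt_i) // /S.
  have rot_inj1 : injective (fun v : n.+1.-tuple 'I_3 => [tuple of rot 1 v]).
    by move=> v w /(congr1 val) /= /rot_inj /val_inj.
  rewrite [RHS](reindex_inj rot_inj1); apply: eq_big => [v|v _] /=.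
    rewrite /content !(seq.permP (permEl (perm_rot 1 v))); congr ((_ == _) && _).
    case/tupleP: v => y v; rewrite rot1_cons /= nth_rcons size_tuple.
    by rewrite (ltnSE lt_i).
  by rewrite F_rot.
transitivity (\sum_(i < n.+1) S i).
  rewrite (eq_bigr (fun=> S 0%N)) => [|i _]; last exact: S_const.
  by rewrite sumr_const card_ord mulr_natl.
rewrite /S; under eq_bigr do rewrite big_mkcondl.
rewrite exchange_big /=; apply: eq_bigr => v _.
rewrite -big_mkcond /= sumr_const -[LHS]mulr_natl; congr (_%:R * _).
rewrite -sum1_card -sum1_count big_tuple; apply: eq_bigl => i.
by rewrite inE (tnth_nth L1).
Qed.

Lemma word_sum_head0 n s m F : (forall w, F (rot 1 w) = F w) ->
  n.+1%:R * \sum_(u : n.-tuple 'I_3 | content s m u) F (L0 :: u) =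
  s.+1%:R * word_sum n.+1 s.+1 m F.
Proof.
move=> F_rot; rewrite /word_sum [RHS]mulr_sumr.
rewrite (eq_bigl (fun u : n.-tuple _ => content s.+1 m (L0 :: u))) => [|u].
  rewrite word_sum_head //; apply: eq_bigr => v /andP[/eqP -> _] //.
by rewrite /content /= add1n eqSS.
Qed.

Lemma word_sum_head2 n s m F : (forall w, F (rot 1 w) = F w) ->
  n.+1%:R * \sum_(u : n.-tuple 'I_3 | content s m u) F (L2 :: u) =
  m.+1%:R * word_sum n.+1 s m.+1 F.
Proof.
move=> F_rot; rewrite /word_sum [RHS]mulr_sumr.
rewrite (eq_bigl (fun u : n.-tuple _ => content s m.+1 (L2 :: u))) => [|u].
  rewrite word_sum_head //; apply: eq_bigr => v /andP[_ /eqP ->] //.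
by rewrite /content /= add1n eqSS.
Qed.

Lemma word_sum_head1 n s m F : (forall w, F (rot 1 w) = F w) ->
  n.+1%:R * \sum_(u : n.-tuple 'I_3 | content s m u) F (L1 :: u) =
  (n.+1 - s - m)%:R * word_sum n.+1 s m F.
Proof.
move=> F_rot; rewrite /word_sum [RHS]mulr_sumr.
rewrite (eq_bigl (fun u : n.-tuple _ => content s m (L1 :: u))) => [|u] //.
rewrite word_sum_head //; apply: eq_bigr => v v_ct; congr (_%:R * _).
have := count_letters v; rewrite size_tuple.
case/andP: v_ct => /eqP-> /eqP-> E.
rewrite -subnDA; apply: (@addnI (s + m)); rewrite addnAC in E.
by rewrite E subnKC // -E leq_addr.
Qed.

(** The multinomial coefficient, by removing a first letter with the three preceding identities at F
    = 1. *)
Lemma word_countE n s m : (s + m <= n)%N ->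
  word_sum n s m (fun=> 1) * (s`! * m`! * (n - s - m)`!)%:R = n`!%:R.
Proof.
elim: n s m => [|n IHn] [|s] [|m] //= le_n.
- rewrite /word_sum (big_pred1 [tuple]) ?mul1r // => v.
  by rewrite tuple0 /= eqxx.
- have := @word_sum_head1 n 0 0 (fun=> 1) (fun=> erefl).
  have := IHn 0%N 0%N isT; rewrite !subn0 !fact0 !mul1n {1}/word_sum.
  by move=> E1 E2; rewrite factS natrM mulrA [_ * n.+1%:R]mulrC -E2 -mulrA E1.
- have := @word_sum_head2 n 0 m (fun=> 1) (fun=> erefl).
  have := IHn 0%N m le_n; rewrite !subn0 ?subSS !fact0 !mul1n {1}/word_sum.
  move=> E1 E2; rewrite factS -mulnA natrM mulrA [_ * m.+1%:R]mulrC -E2.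
  by rewrite -mulrA E1 -natrM -factS.
- have := @word_sum_head0 n s 0 (fun=> 1) (fun=> erefl).
  have := IHn s 0%N le_n; rewrite !subn0 ?subSS !fact0 !muln1 {1}/word_sum.
  move=> E1 E2; rewrite factS -mulnA natrM mulrA [_ * s.+1%:R]mulrC -E2.
  by rewrite -mulrA E1 -natrM -factS.
- have := @word_sum_head0 n s m.+1 (fun=> 1) (fun=> erefl).
  have := IHn s m.+1 le_n; rewrite ?subSS {1}/word_sum.
  move=> E1 E2.
  have -> : (s.+1`! * m.+1`! * (n - s - m.+1)`! =
      s.+1 * (s`! * m.+1`! * (n - s - m.+1)`!))%N.
    by rewrite [s.+1`!]factS !mulnA.
  by rewrite natrM mulrA [_ * s.+1%:R]mulrC -E2 -mulrA E1 -natrM -factS.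
Qed.

Lemma word_count_neq0 n s m : (s + m <= n)%N -> word_sum n s m (fun=> 1) != 0.
Proof.
move=> le_n; apply: contraTneq (fact_gt0 n) => E.
by rewrite -(ltr0n R) -(word_countE le_n) E mul0r ltxx.
Qed.

(** The measure is proportional to the uniform one, for which the first two letters are drawn
    without replacement from s letters 0 and m letters 2. *)
Lemma uniform_two_point n s m (mu : n.+2.-tuple 'I_3 -> R) (q : R) x y :
  0 <= q -> (s + m = n.+2)%N -> (x, y) \in [:: (L0, L2); (L2, L0)] ->
  weakly_stationary (@swap n.+2) (@bond_rate R q n.+2) mu ->
  (forall v, mu v != 0 -> content s m v) ->
  (n.+2 * n.+1)%:R * (\sum_(v : n.+2.-tuple 'I_3 |
     (nth L1 v 0 == x) && (nth L1 v 1 == y)) mu v) =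
  (s * m)%:R * \sum_v mu v.
Proof.
move=> q_ge0 eq_sm xy mu_st mu_ct.
have one_rot (w : seq 'I_3) : 1 = 1 :> R by [].
have unif_ct (v : n.+2.-tuple 'I_3) : (content s m v)%:R != 0 :> R -> content s m v.
  by case: content => //; rewrite eqxx.
have prop := words_proportional q_ge0 mu_st mu_ct
  (uniform_weakly_stationary q eq_sm) unif_ct.
have N_sum : \sum_(v : n.+2.-tuple 'I_3) (content s m v)%:R =
    word_sum n.+2 s m (fun=> 1) :> R.
  by rewrite /word_sum [RHS]big_mkcond /=; apply: eq_bigr => v _; case: content.
have N_neq0 : word_sum n.+2 s m (fun=> 1) != 0 by rewrite word_count_neq0 // eq_sm.
apply: (mulfI N_neq0); rewrite [in LHS]mulrCA -[in LHS]N_sum mulr_sumr.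
under eq_bigr do rewrite prop.
rewrite -mulr_sumr mulrCA [RHS]mulrC -[RHS]mulrA [RHS]mulrCA; congr (_ * _).
transitivity ((n.+2 * n.+1)%:R * word_sum2 n.+2 s m x y (fun=> 1)).
  congr (_ * _); rewrite /word_sum2.
  under [RHS]eq_bigl do rewrite andbA.
  by rewrite [RHS]big_mkcondr /=; apply: eq_bigr => v _; case: content.
rewrite word_sum2E; case: s m eq_sm {mu_ct unif_ct prop N_sum N_neq0} => [|s] [|m] eq_sm.
- by [].
- rewrite mul0n mul0r big_pred0 ?mulr0 // => u.
  by move: xy; rewrite !inE => /orP[]/eqP[-> ->]; rewrite /content /=; case: (count_mem L0 u).
- rewrite muln0 mul0r big_pred0 ?mulr0 // => u.
  by move: xy; rewrite !inE => /orP[]/eqP[-> ->]; rewrite /content /= ?add0n add1n andbF.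
rewrite (eq_bigl (fun u : n.-tuple _ => content s m u)) => [|u]; last first.
  by move: xy; rewrite !inE => /orP[]/eqP[-> ->]; rewrite /content /=
    ?add0n ?add1n !eqSS.
have E1 := @word_sum_head0 n s m (fun=> 1) one_rot.
have E2 := @word_sum_head2 n.+1 s.+1 m (fun=> 1) one_rot.
rewrite natrM -mulrA {1}E1 mulrCA -/(word_sum n.+1 s.+1 m (fun=> 1)).
by rewrite {1}/word_sum E2 mulrA -natrM.
Qed.

End WordSums.

(** * Two-point functions of three-letter words *)

Lemma sum_pushforward (R : realFieldType) (T U : finType) (p : T -> U)
    (P : pred U) (mu : T -> R) :
  \sum_(u | P u) \sum_(x | p x == u) mu x = \sum_(x | P (p x)) mu x.
Proof.
rewrite (exchange_big_dep (fun x => P (p x))) /= => [|u x Pu /eqP -> //].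
apply: eq_bigr => x Px; rewrite (big_pred1 (p x)) // => u /=.
by case: eqVneq => [<-|_]; rewrite ?Px ?eqxx ?andbF // eq_sym.
Qed.

Lemma swap_id n (v : n.-tuple 'I_3) k :
  tnth v k = tnth v (ordS k) -> swap v k = v.
Proof.
move=> vk; apply: eq_from_tnth => i; rewrite tnth_mktuple.
by case: tpermP => [->|->|].
Qed.

Definition merge12 (x : 'I_3) : 'I_3 := if x == L1 then L2 else x.

(** Merging is monotone: exchanges of letters that stay distinct keep their rates, and an exchange
    of 1 and 2 becomes invisible. *)
Lemma merge12_weakly_stationary (R : realFieldType) (q : R) n
    (mu : n.-tuple 'I_3 -> R) :
  weakly_stationary (@swap n) (@bond_rate R q n) mu ->
  weakly_stationary (@swap n) (@bond_rate R q n)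
    (fun u => \sum_(v | map_tuple merge12 v == u) mu v).
Proof.
apply: weakly_stationary_lump => v k.
  by apply: eq_from_tnth => i; rewrite !(tnth_map, tnth_mktuple).
have [eq_k|neq_k] := eqVneq (merge12 (tnth v k)) (merge12 (tnth v (ordS k))).
  by right; apply: swap_id; rewrite !tnth_map.
left; rewrite /bond_rate !tnth_map; move: neq_k.
by elim/letterP: (tnth v k); elim/letterP: (tnth v (ordS k)).
Qed.

Lemma content_merge12 s m (v : seq 'I_3) : content s m v ->
  content s (size v - s) (map merge12 v).
Proof.
rewrite /content => /andP[/eqP <- _]; apply/andP.
have E x : count_mem x (map merge12 v) = count (fun y => merge12 y == x) v.
  by rewrite count_map.
have E0 : count_mem L0 (map merge12 v) = count_mem L0 v.
  by rewrite E; apply: eq_count => y; elim/letterP: y.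
split; first by rewrite E0.
have := count_letters (map merge12 v); rewrite size_map E0 => <-.
rewrite (_ : count_mem L1 _ = 0%N) ?addn0 ?addKn //.
by rewrite E -[RHS](count_pred0 v); apply: eq_count => y; elim/letterP: y.
Qed.

(** * Partition function and two-point weights of the matrix product *)

Section ThreeLetters.

Variables (R : realFieldType) (q : R).
Hypotheses (hq0 : 0 <= q) (hq1 : q < 1).

Let weight_rot1 w : weight q (rot 1 w) = weight q w.
Proof. by case: w => [//|x w]; rewrite rot1_cons (weight_rcons hq0 hq1). Qed.

Let Z n s m := word_sum n s m (weight q).
Let T n s m x y := word_sum2 n s m x y (weight q).

Let q1_neq0 : 1 - q != 0. Proof. by rewrite subr_eq0 gt_eqF. Qed.

(** Merging leaves s letters 0 and n + 2 - s letters 2, for which the stationary measure is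
    uniform. *)
Let merged_two_point n s m x y : (s + m < n.+2)%N ->
  (x, y) \in [:: (L0, L2); (L2, L0)] ->
  (n.+2 * n.+1)%:R *
    (\sum_(v : n.+2.-tuple 'I_3 | [&& merge12 (nth L1 v 0) == x,
       merge12 (nth L1 v 1) == y & content s m v]) weight q v) =
  (s * (n.+2 - s))%:R * Z n.+2 s m.
Proof.
move=> lt_sm xy; have st := weight_weakly_stationary hq0 hq1 lt_sm.
have := uniform_two_point hq0 _ xy (merge12_weakly_stationary st).
move=> /(_ s (n.+2 - s)%N); rewrite subnKC; last by lia.
move=> /(_ erefl) H.
have {H} := H _; rewrite !sum_pushforward /Z /word_sum [\sum_(v | content _ _ _) _]big_mkcond /=.
move=> <- => [|u]; last first.
  apply: contraR => u_ct; apply/eqP; apply: big1 => v /eqP vu.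
  case: ifP => // /content_merge12; rewrite size_tuple => v_ct.
  by rewrite -vu v_ct in u_ct.
congr (_ * _); under eq_bigl do rewrite andbA.
rewrite big_mkcondr /=; apply: eq_bigl => v.
by case/tupleP: v => a v; case/tupleP: v => b v.
Qed.

Let two_letter_bond n s m : (s.+1 + m < n.+2)%N ->
  n.+1%:R * (T n.+2 s.+1 m L1 L0 - q * T n.+2 s.+1 m L0 L1) =
  (1 - q) * (n.+1 - s - m)%:R * Z n.+1 s m.
Proof.
move=> lt_sm; rewrite -[RHS]mulrA -(word_sum_head1 n s m weight_rot1) mulrCA.
congr (_ * _); rewrite /T !word_sum2E !mulr_sumr -sumrB.
by apply: eq_bigr => u _; rewrite (weight_10 q); ring.
Qed.

(** [weight_02] summed over tails: each of its terms has one letter before the tail, so it yields a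
    partition function of size n + 1. *)
Let T_02 n s m : (s.+1 + m.+1 < n.+2)%N ->
  n.+1%:R * T n.+2 s.+1 m.+1 L0 L2 =
  s.+1%:R * Z n.+1 s.+1 m + m.+1%:R * Z n.+1 s m.+1
  - (n.+1 - s - m)%:R * Z n.+1 s m.
Proof.
move=> lt_sm; rewrite /T word_sum2E.
rewrite (eq_bigl (fun u : n.-tuple _ => content s m u)) //.
rewrite -(word_sum_head0 n s m weight_rot1) -(word_sum_head1 n s m weight_rot1).
rewrite -(word_sum_head2 n s m weight_rot1) -mulrDr -mulrBr -big_split -sumrB.
congr (_ * _); apply: eq_bigr => u u_ct; rewrite weight_02 //.
have := count_letters u; rewrite size_tuple.
case/andP: u_ct => /eqP-> /eqP-> E; lia.
Qed.

Let T_20 n s m : (s.+1 + m.+1 < n.+2)%N ->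
  n.+1%:R * T n.+2 s.+1 m.+1 L2 L0 =
  s.+1%:R * Z n.+1 s.+1 m + m.+1%:R * Z n.+1 s m.+1
  - q * ((n.+1 - s - m)%:R * Z n.+1 s m).
Proof.
move=> lt_sm; rewrite /T word_sum2E.
rewrite (eq_bigl (fun u : n.-tuple _ => content s m u)) //.
rewrite -(word_sum_head0 n s m weight_rot1) -(word_sum_head1 n s m weight_rot1).
rewrite -(word_sum_head2 n s m weight_rot1) mulrCA -mulrDr -mulrBr.
congr (_ * _); rewrite mulr_sumr -big_split -sumrB; apply: eq_bigr => u u_ct; rewrite weight_20 //.
have := count_letters u; rewrite size_tuple.
case/andP: u_ct => /eqP-> /eqP-> E; lia.
Qed.

Let merged_sum n s m : (s + m < n.+2)%N ->
  (n.+2 * n.+1)%:R * (T n.+2 s m L0 L1 + T n.+2 s m L0 L2) =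
    (s * (n.+2 - s))%:R * Z n.+2 s m /\
  (n.+2 * n.+1)%:R * (T n.+2 s m L1 L0 + T n.+2 s m L2 L0) =
    (s * (n.+2 - s))%:R * Z n.+2 s m.
Proof.
move=> lt_sm; rewrite -(@merged_two_point n s m L0 L2) //.
split; last rewrite (merged_two_point lt_sm (x := L0) (y := L2)) //
   -(@merged_two_point n s m L2 L0) //; congr (_ * _).
all: rewrite /T /word_sum2 !(big_mkcond (fun v => [&& _, _ & _])) -big_split /=.
all: apply: eq_bigr => v _; rewrite /merge12.
all: by elim/letterP: (nth L1 v 0); elim/letterP: (nth L1 v 1);
  rewrite /= ?addr0 ?add0r.
Qed.

(** The combination T_10 + T_20 - q (T_01 + T_02) is computed twice: merging gives the partition
    function of size n + 2, the exchange relations give those of size n + 1. The terms with one more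
    letter 1 cancel between 20 and 02. *)
Let Z_rec n s m : (s.+1 + m < n.+2)%N ->
  n.+2%:R * ((n.+2 - s.+1)%:R * Z n.+1 s m
             + (if m is m'.+1 then s.+1%:R * Z n.+1 s.+1 m' else 0)) =
  (s.+1 * (n.+2 - s.+1))%:R * Z n.+2 s.+1 m.
Proof.
move=> lt_sm; have [E1 E2] := merged_sum lt_sm.
have E3 := two_letter_bond lt_sm.
apply: (mulfI q1_neq0).
have -> : (1 - q) * ((s.+1 * (n.+2 - s.+1))%:R * Z n.+2 s.+1 m) =
    (n.+2 * n.+1)%:R * (T n.+2 s.+1 m L1 L0 - q * T n.+2 s.+1 m L0 L1)
    + (n.+2 * n.+1)%:R * (T n.+2 s.+1 m L2 L0 - q * T n.+2 s.+1 m L0 L2).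
  by rewrite mulrBl mul1r -{1}E2 -E1; ring.
rewrite natrM -!mulrA E3; case: m lt_sm {E1 E2 E3} => [|m] lt_sm.
  have T0 x y : (x == L2) || (y == L2) -> T n.+2 s.+1 0 x y = 0.
    move=> xy; rewrite /T word_sum2E big_pred0 // => u.
    by rewrite /content; case/orP: xy => /eqP ->; rewrite /= ?add1n ?addnS andbF.
  by rewrite !T0 // subn0; ring.
have E4 := T_02 lt_sm; have E5 := T_20 lt_sm.
rewrite [n.+1%:R * (T _ _ _ _ _ - _)]mulrBr E5 [n.+1%:R * (q * _)]mulrCA E4.
have -> : (n.+2 - s.+1)%:R = (n.+1 - s - m.+1)%:R + m.+1%:R :> R.
  by rewrite -natrD; congr _%:R; lia.
ring.
Qed.

(** Induction on n: without letters 0 all weights are equal by [weight_no0]; otherwise in [Z_rec]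
    all terms have the same number n - s - m of letters 1, hence the same denominator, and
    absorption for binomial coefficients remains. *)
Lemma word_sum_weight n s m : (s + m < n)%N ->
  word_sum n s m (weight q) =
  ('C(n, s) * 'C(n, m))%:R / (1 - q ^+ (n - s - m)).
Proof.
elim: n s m => // n IHn [|s] m lt_sm.
  rewrite bin0 mul1n; have -> : 'C(n.+1, m)%:R = word_sum n.+1 0 m (fun=> 1) :> R.
    have f_neq0 : (m`! * (n.+1 - m)`!)%:R != 0 :> R.
      by rewrite pnatr_eq0 -lt0n muln_gt0 !fact_gt0.
    apply: (mulIf f_neq0); rewrite -natrM bin_fact; last exact: ltnW.
    by rewrite -(@word_countE R n.+1 0 m) ?(ltnW lt_sm) // fact0 mul1n subn0.
  rewrite /word_sum mulr_suml; apply: eq_bigr => v v_ct.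
  have := count_letters v; case/andP: v_ct => /eqP v0 /eqP ->; rewrite v0 size_tuple => E.
  rewrite mul1r weight_no0 //; last by apply/count_memPn.
  by rewrite subn0; have -> : count_mem L1 v = (n.+1 - m)%N by rewrite -[in RHS]E addnK.
case: n IHn lt_sm => [|n] IHn lt_sm; first by lia.
have := Z_rec lt_sm; rewrite /Z IHn; last by lia.
rewrite (_ : (n.+1 - s - m = n.+2 - s.+1 - m)%N); last by lia.
set D := (1 - q ^+ _)^-1.
have n2_neq0 : n.+2%:R != 0 :> R by rewrite pnatr_eq0.
have s1_neq0 : (s.+1 * (n.+2 - s.+1))%:R != 0 :> R.
  by rewrite pnatr_eq0 muln_eq0 /= -lt0n subn_gt0; lia.
have B1 : n.+2%:R * 'C(n.+1, s)%:R = s.+1%:R * 'C(n.+2, s.+1)%:R :> R.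
  by rewrite -!natrM mul_bin_diag.
have B2 : n.+2%:R * 'C(n.+1, m)%:R = (n.+2 - m)%:R * 'C(n.+2, m)%:R :> R.
  by rewrite -!natrM -mul_bin_down.
have B3 : n.+2%:R * 'C(n.+1, s.+1)%:R = (n.+2 - s.+1)%:R * 'C(n.+2, s.+1)%:R :> R.
  by rewrite -!natrM -mul_bin_down.
move=> Zrec; apply: (mulfI s1_neq0); apply: (mulfI n2_neq0); rewrite -Zrec {Zrec}.
case: m lt_sm B2 @D => [|m] lt_sm B2 D.
  rewrite addr0 natrM !bin0 natrM.
  transitivity (n.+2%:R * (n.+2 - s.+1)%:R * (n.+2%:R * 'C(n.+1, s)%:R) * D); first by ring.
  by rewrite B1 !natrM; ring.
rewrite IHn; last by lia.
rewrite (_ : (n.+1 - s.+1 - m = n.+2 - s.+1 - m.+1)%N) -/D; last by lia.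
have B4 : n.+2%:R * 'C(n.+1, m)%:R = m.+1%:R * 'C(n.+2, m.+1)%:R :> R.
  by rewrite -!natrM mul_bin_diag.
transitivity (((n.+2 - s.+1)%:R * (n.+2%:R * 'C(n.+1, s)%:R) * (n.+2%:R * 'C(n.+1, m.+1)%:R)
  + s.+1%:R * (n.+2%:R * 'C(n.+1, s.+1)%:R) * (n.+2%:R * 'C(n.+1, m)%:R)) * D).
  by rewrite !natrM; ring.
rewrite B1 B2 B3 B4 !natrM (natrB _ (_ : (m.+1 <= n.+2)%N)); last by lia.
by ring.
Qed.

(** Absorption for binomial coefficients. In the last identity the shorter words have one more
    letter 1, so the denominators differ. *)
Let partition_ratios n s m : (s.+1 + m.+1 < n.+2)%N ->
  [/\ n.+2%:R ^+ 2 * Z n.+1 s.+1 m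
        = (n.+2%:R - s.+1%:R) * m.+1%:R * Z n.+2 s.+1 m.+1,
      n.+2%:R ^+ 2 * Z n.+1 s m.+1
        = s.+1%:R * (n.+2%:R - m.+1%:R) * Z n.+2 s.+1 m.+1
    & n.+2%:R ^+ 2 * (1 - q ^+ (n.+1 - s - m)) * Z n.+1 s m
        = s.+1%:R * m.+1%:R * (1 - q ^+ (n - s - m)) * Z n.+2 s.+1 m.+1].
Proof.
move=> lt_sm; rewrite /Z !word_sum_weight; try lia.
have -> : (n.+1 - s.+1 - m = n - s - m)%N by lia.
have -> : (n.+1 - s - m.+1 = n - s - m)%N by lia.
have qpow k : (0 < k)%N -> 1 - q ^+ k != 0.
  by case: k => // k _; rewrite subr_eq0 eq_sym lt_eqF // exprn_ilt1.
have k_gt0 : (0 < n - s - m)%N by lia.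
have k1_gt0 : (0 < n.+1 - s - m)%N by lia.
move: (qpow _ k_gt0) (qpow _ k1_gt0).
set D := 1 - q ^+ _; set D1 := 1 - q ^+ _ => D_neq0 D1_neq0.
clearbody D D1.
have diag a : n.+2%:R * 'C(n.+1, a)%:R = a.+1%:R * 'C(n.+2, a.+1)%:R :> R.
  by rewrite -!natrM mul_bin_diag.
have down a : (a.+1 <= n.+2)%N -> n.+2%:R * 'C(n.+1, a.+1)%:R =
    (n.+2%:R - a.+1%:R) * 'C(n.+2, a.+1)%:R :> R.
  by move=> le_a; rewrite -natrB // -!natrM -mul_bin_down.
split.
- transitivity ((n.+2%:R * 'C(n.+1, s.+1)%:R) * (n.+2%:R * 'C(n.+1, m)%:R) / D).
    by rewrite natrM; ring.
  by rewrite (diag m) (down s); [rewrite natrM; ring | lia].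
- transitivity ((n.+2%:R * 'C(n.+1, s)%:R) * (n.+2%:R * 'C(n.+1, m.+1)%:R) / D).
    by rewrite natrM; ring.
  by rewrite (diag s) (down m); [rewrite natrM; ring | lia].
- transitivity ((n.+2%:R * 'C(n.+1, s)%:R) * (n.+2%:R * 'C(n.+1, m)%:R) * (D1 / D1)).
    by rewrite natrM; ring.
  rewrite divff // (diag s) (diag m) natrM.
  transitivity (s.+1%:R * 'C(n.+2, s.+1)%:R * (m.+1%:R * 'C(n.+2, m.+1)%:R) * (D / D)).
    by rewrite divff.
  by ring.
Qed.

Lemma qint_geometric k : (1 - q) * qint q k = 1 - q ^+ k.
Proof. by rewrite -[RHS]opprB subrX1 -mulNr opprB. Qed.

Lemma qint_neq0 k : qint q k.+1 != 0.
Proof.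
have qk : 1 - q ^+ k.+1 != 0 by rewrite subr_eq0 eq_sym lt_eqF // exprn_ilt1.
by apply: contraNneq qk => qk0; rewrite -qint_geometric qk0 mulr0.
Qed.

Let Z_neq0 n s m : (s + m < n)%N -> Z n s m != 0.
Proof.
move=> lt_sm; rewrite /Z word_sum_weight // mulf_neq0 //.
  by rewrite pnatr_eq0 -lt0n muln_gt0 !bin_gt0; lia.
rewrite invr_eq0 subr_eq0 eq_sym lt_eqF // exprn_ilt1 //.
by rewrite -lt0n -subnDA subn_gt0.
Qed.

Let weight_two_point n s m : (s.+1 + m.+1 < n.+2)%N ->
  let k := (n - s - m)%N in
  n.+2%:R ^+ 2 * n.+1%:R * qint q k.+1 * T n.+2 s.+1 m.+1 L0 L2 =
    (s.+1 * m.+1)%:R * (n.+1%:R * qint q k.+1 + k.+1%:R * q ^+ k) * Z n.+2 s.+1 m.+1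
  /\
  n.+2%:R ^+ 2 * n.+1%:R * qint q k.+1 * T n.+2 s.+1 m.+1 L2 L0 =
    (s.+1 * m.+1)%:R * (n.+1%:R * qint q k.+1 + k.+1%:R) * Z n.+2 s.+1 m.+1.
Proof.
move=> lt_sm k; have [r1 r2 r3] := partition_ratios lt_sm.
have E1 := T_02 lt_sm; have E2 := T_20 lt_sm.
have kE : (n.+1 - s - m = k.+1)%N by rewrite /k; lia.
have nE : n.+1%:R = s%:R + m%:R + k.+1%:R :> R.
  by rewrite -!natrD; congr _%:R; rewrite /k; lia.
have n2E : n.+2%:R = s%:R + m%:R + k.+1%:R + 1 :> R by rewrite -nE natr1.
move: r3 E1 E2; rewrite -/k kE -!qint_geometric => r3 E1 E2.
have {}r3 : n.+2%:R ^+ 2 * qint q k.+1 * Z n.+1 s m =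
    s.+1%:R * m.+1%:R * qint q k * Z n.+2 s.+1 m.+1.
  by apply: (mulfI q1_neq0); lra.
(* The first splitting of [k + 1] produces the q^k of the 02 case, the second the 1 of the 20
   case. *)
have qk : qint q k.+1 = qint q k + q ^+ k by rewrite /qint big_ord_recr.
have qk' : qint q k.+1 = 1 + q * qint q k.
  rewrite /qint big_ord_recl expr0 mulr_sumr; congr (_ + _).
  by apply: eq_bigr => i _; rewrite /= exprS.
split.
- transitivity (n.+2%:R ^+ 2 * qint q k.+1 * (n.+1%:R * T n.+2 s.+1 m.+1 L0 L2)); first by ring.
  rewrite E1.
  transitivity (qint q k.+1 * (s.+1%:R * (n.+2%:R ^+ 2 * Z n.+1 s.+1 m)
     + m.+1%:R * (n.+2%:R ^+ 2 * Z n.+1 s m.+1))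
     - k.+1%:R * (n.+2%:R ^+ 2 * qint q k.+1 * Z n.+1 s m)); first by ring.
  by rewrite r1 r2 r3 natrM nE n2E qk -!natr1; ring.
- transitivity (n.+2%:R ^+ 2 * qint q k.+1 * (n.+1%:R * T n.+2 s.+1 m.+1 L2 L0)); first by ring.
  rewrite E2.
  transitivity (qint q k.+1 * (s.+1%:R * (n.+2%:R ^+ 2 * Z n.+1 s.+1 m)
     + m.+1%:R * (n.+2%:R ^+ 2 * Z n.+1 s m.+1))
     - q * k.+1%:R * (n.+2%:R ^+ 2 * qint q k.+1 * Z n.+1 s m)); first by ring.
  by rewrite r1 r2 r3 natrM nE n2E qk' -!natr1; ring.
Qed.

(** Three regimes: uniform if there are no letters 1, zero if 0 or 2 is missing, otherwise
    proportional to the matrix product measure. *)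
Lemma three_letter_two_point n s m (mu : n.+2.-tuple 'I_3 -> R) :
  (s + m <= n.+2)%N ->
  weakly_stationary (@swap n.+2) (@bond_rate R q n.+2) mu ->
  (forall v, mu v != 0 -> content s m v) ->
  let k := (n.+2 - s - m)%N in
  n.+2%:R ^+ 2 * n.+1%:R * qint q k.+1 *
    (\sum_(v : n.+2.-tuple 'I_3 | (nth L1 v 0 == L0) && (nth L1 v 1 == L2)) mu v) =
    (s * m)%:R * (n.+1%:R * qint q k.+1 + k.+1%:R * q ^+ k) * \sum_v mu v
  /\
  n.+2%:R ^+ 2 * n.+1%:R * qint q k.+1 *
    (\sum_(v : n.+2.-tuple 'I_3 | (nth L1 v 0 == L2) && (nth L1 v 1 == L0)) mu v) =
    (s * m)%:R * (n.+1%:R * qint q k.+1 + k.+1%:R) * \sum_v mu v.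
Proof.
rewrite leq_eqVlt => /predU1P[eq_sm|lt_sm] mu_st mu_ct k.
  have k0 : k = 0%N by rewrite /k -subnDA eq_sm subnn.
  have q1 : qint q 1 = 1 by rewrite /qint big_ord1 expr0.
  rewrite k0 q1 expr0.
  have unif x y xy := @uniform_two_point _ _ _ _ mu q x y hq0 eq_sm xy mu_st mu_ct.
  split.
  - have := unif L0 L2; rewrite !inE eqxx => /(_ isT)/(congr1 ( *%R n.+2%:R)).
    by rewrite natrM -[n.+2%:R]natr1; lra.
  - have := unif L2 L0; rewrite !inE eqxx orbT => /(_ isT)/(congr1 ( *%R n.+2%:R)).
    by rewrite natrM -[n.+2%:R]natr1; lra.
have [sm0|] := eqVneq (s * m)%N 0%N.
  rewrite sm0 !mul0r.
  have z x y : (x, y) \in [:: (L0, L2); (L2, L0)] ->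
      \sum_(v : n.+2.-tuple 'I_3 | (nth L1 v 0 == x) && (nth L1 v 1 == y)) mu v = 0.
    move=> xy; apply: big1 => v vxy; apply/eqP; apply: contraTT xy => /mu_ct.
    move: vxy; case/tupleP: v => a v; case/tupleP: v => b v /= /andP[/eqP-> /eqP->].
    move=> /andP[/eqP s_ct /eqP m_ct]; apply/negP; rewrite !inE => /orP[]/eqP[ax bx].
    - have : (0 < s * m)%N by rewrite muln_gt0 -s_ct -m_ct ax bx.
      by rewrite sm0.
    - have : (0 < s * m)%N by rewrite muln_gt0 -s_ct -m_ct ax bx.
      by rewrite sm0.
  by rewrite !z ?mulr0.
case: s lt_sm mu_ct @k => // s; case: m => [|m]; first by rewrite muln0.
move=> lt_sm mu_ct k _.
have nu_st := weight_weakly_stationary hq0 hq1 lt_sm.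
have nu_ct (v : n.+2.-tuple 'I_3) :
    (if content s.+1 m.+1 v then weight q v else 0) != 0 -> content s.+1 m.+1 v.
  by case: ifP => //; rewrite eqxx.
have prop := words_proportional hq0 mu_st mu_ct nu_st nu_ct.
have Zmu x y : Z n.+2 s.+1 m.+1 * (\sum_(v : n.+2.-tuple 'I_3 |
    (nth L1 v 0 == x) && (nth L1 v 1 == y)) mu v) =
    (\sum_v mu v) * T n.+2 s.+1 m.+1 x y.
  rewrite {1}/Z /word_sum big_mkcond mulr_sumr (eq_bigr _ (fun v _ => prop v)).
  rewrite -mulr_sumr -big_mkcondr; congr (_ * _); apply: eq_bigl => v.
  by rewrite andbA.
have kE : k = (n - s - m)%N by rewrite /k; lia.
have [E1 E2] := weight_two_point lt_sm; rewrite -kE in E1 E2.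
split; apply: (mulfI (Z_neq0 lt_sm)); rewrite [LHS]mulrCA Zmu mulrCA.
  by rewrite E1; ring.
by rewrite E2; ring.
Qed.

End ThreeLetters.

(** * From permutations to words *)

(** The diagonal of the generator turns g w' into the increment g w' - g w, so targets w' = w drop
    out. Then [jump_rate] is split by bonds, which may share a target, as both do for n = 2. *)
Lemma stationary_weakly_stationary (R : realFieldType) (q : R) n
    (mu : {ffun {perm 'I_n} -> R}) : stationary q mu ->
  weakly_stationary (@exchange n)
    (fun w k => exchange_rate q (label w k) (label w (ordS k))) mu.
Proof.
case=> _ _ mu_st g.
transitivity (\sum_w' g w' * \sum_w mu w * generator q w w'); last first.
  by apply: big1 => w' _; rewrite mu_st mulr0.
under [RHS]eq_bigr do rewrite mulr_sumr.
rewrite [RHS]exchange_big; apply: eq_bigr => w _.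
under [RHS]eq_bigr do rewrite mulrCA.
rewrite -mulr_sumr; congr (_ * _).
transitivity (\sum_w' (g w' - g w) * jump_rate q w w').
  rewrite /jump_rate; under [RHS]eq_bigr do rewrite mulr_sumr big_mkcond.
  rewrite exchange_big; apply: eq_bigr => k _.
  rewrite -big_mkcond (big_pred1 (exchange w k)) => [|w' /=]; first by rewrite mulrC.
  by rewrite eq_sym.
rewrite (bigD1 w) //= subrr mul0r add0r [RHS](bigD1 w) //=.
rewrite {1}/generator eqxx mulrN mulr_sumr -sumrN -big_split /=.
apply: eq_bigr => w' /negPf w'w; rewrite /generator eq_sym w'w mulrBl addrC //.
Qed.

(** Ordinals are labels minus one, so for s <= t the classes are the labels at most s, those in (s,
    t] and those above t. *)
Definition species (n s t : nat) (x : 'I_n) : 'I_3 :=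
  if (x < s)%N then L0 else if (x < t)%N then L1 else L2.

Definition species_word (n s t : nat) (w : {perm 'I_n}) : n.-tuple 'I_3 :=
  [tuple species s t (w i) | i < n].

Lemma species_word_weakly_stationary (R : realFieldType) (q : R) n s t
    (mu : {ffun {perm 'I_n} -> R}) : (s <= t)%N -> stationary q mu ->
  weakly_stationary (@swap n) (@bond_rate R q n)
    (fun v => \sum_(w | species_word s t w == v) mu w).
Proof.
move=> le_st /stationary_weakly_stationary; apply: weakly_stationary_lump => w k.
  by apply: eq_from_tnth => i; rewrite !tnth_mktuple permM.
have [eq_k|neq_k] := eqVneq (species s t (w k)) (species s t (w (ordS k))).
  by right; apply: swap_id; rewrite !tnth_mktuple.
left; rewrite /bond_rate !tnth_mktuple /exchange_rate /label !ltnS.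
have mono (x y : 'I_n) : species s t x != species s t y ->
    (x < y)%N = (species s t x < species s t y)%N.
  rewrite /species.
  case: (ltnP x s) => xs; case: (ltnP x t) => xt; case: (ltnP y s) => ys;
    case: (ltnP y t) => yt //= _; case: (ltnP x y) => //; lia.
by rewrite (mono _ _ neq_k) (mono (w (ordS k))) // eq_sym.
Qed.

Lemma species_word_content n s t (w : {perm 'I_n}) : (s <= t <= n)%N ->
  content s (n - t) (species_word s t w).
Proof.
move=> /andP[le_st le_tn].
have cnt x : count_mem x (species_word s t w) = #|[pred i : 'I_n | species s t i == x]|.
  rewrite -sum1_count big_tuple -sum1_card [RHS](reindex_inj (@perm_inj _ w)).
  by apply: eq_bigl => i; rewrite tnth_mktuple inE.
have cltn a : (a <= n)%N -> #|[pred i : 'I_n | (i < a)%N]| = a.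
  move=> le_an; rewrite -sum1_card -(big_ord_widen _ (fun=> 1%N) le_an).
  by rewrite sum_nat_const card_ord muln1.
rewrite /content !cnt; apply/andP; split; apply/eqP.
  rewrite -[RHS](cltn s) ?(leq_trans le_st) //; apply: eq_card => i.
  by rewrite !inE /species; case: ifP => // _; case: ifP.
have := cardC [pred i : 'I_n | (i < t)%N]; rewrite cltn // card_ord => E.
apply: (@addnI t); rewrite subnKC // -[RHS]E; congr (_ + _)%N.
apply: eq_card => i; rewrite !inE /species -leqNgt.
case: ltnP => [lt_is|_]; last by case: ltnP.
by rewrite leqNgt (leq_trans lt_is le_st).
Qed.

(** * Two-point probabilities of the multispecies chain *)

Section TwoPoint.

Variables (R : realFieldType) (q : R) (n : nat).
Hypotheses (hq0 : 0 <= q) (hq1 : q < 1).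
Variable mu : {ffun {perm 'I_n.+2} -> R}.
Hypothesis mu_st : stationary q mu.

Let i0 : 'I_n.+2 := ord0.
Let i1 : 'I_n.+2 := lift ord0 ord0.

(** Corner distribution functions of the labels at the first two sites, one label at most s and the
    other above t: this is what the projection to three species determines. *)
Definition prob_up (s t : nat) : R :=
  \sum_(w : {perm 'I_n.+2} | (w i0 < s)%N && (t <= w i1)%N) mu w.
Definition prob_down (s t : nat) : R :=
  \sum_(w : {perm 'I_n.+2} | (t <= w i0)%N && (w i1 < s)%N) mu w.

Lemma prob_up_downE s k : (s + k <= n.+2)%N ->
  prob_up s (s + k) =
  s%:R * (n.+2%:R - (s + k)%:R)
    * (n.+1%:R + k.+1%:R * q ^+ k / qint q k.+1) / (n.+2%:R ^+ 2 * n.+1%:R) /\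
  prob_down s (s + k) =
  s%:R * (n.+2%:R - (s + k)%:R)
    * (n.+1%:R + k.+1%:R / qint q k.+1) / (n.+2%:R ^+ 2 * n.+1%:R).
Proof.
move=> le_sk; set t := (s + k)%N.
have le_st : (s <= t)%N by apply: leq_addr.
have le_sm : (s + (n.+2 - t) <= n.+2)%N by rewrite /t; lia.
have := three_letter_two_point hq0 hq1 le_sm
  (species_word_weakly_stationary le_st mu_st).
have -> : (n.+2 - s - (n.+2 - t) = k)%N by rewrite /t; lia.
rewrite !sum_pushforward => -[v|].
  apply: contraR => v_ct; apply/eqP; apply: big1 => w /eqP wv.
  by rewrite -wv species_word_content ?le_st // in v_ct.
have nth0 w : nth L1 (species_word s t w) 0 = species s t (w i0).
  by rewrite -(tnth_mktuple (fun i => species s t (w i)) i0) (tnth_nth L1).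
have nth1 w : nth L1 (species_word s t w) 1 = species s t (w i1).
  by rewrite -(tnth_mktuple (fun i => species s t (w i)) i1) (tnth_nth L1).
have is0 x : (species s t x == L0) = (x < s)%N.
  by rewrite /species; case: ifP => // _; case: ifP.
have is2 (x : 'I_n.+2) : (species s t x == L2) = (t <= x)%N.
  rewrite /species; case: ltnP => [lt_xs|_]; last by case: ltnP.
  by rewrite leqNgt (leq_trans lt_xs le_st).
have -> : \sum_(w | (nth L1 (species_word s t w) 0 == L0)
    && (nth L1 (species_word s t w) 1 == L2)) mu w = prob_up s t.
  by apply: eq_bigl => w; rewrite nth0 nth1 is0 is2.
have -> : \sum_(w | (nth L1 (species_word s t w) 0 == L2)
    && (nth L1 (species_word s t w) 1 == L0)) mu w = prob_down s t.
  by apply: eq_bigl => w; rewrite nth0 nth1 is0 is2.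
have [_ -> _] := mu_st; rewrite !mulr1 natrM natrB //.
have n2 : n.+2%:R != 0 :> R by rewrite pnatr_eq0.
have n1 : n.+1%:R != 0 :> R by rewrite pnatr_eq0.
move: (qint_neq0 hq0 hq1 k) n2 n1.
move: (n.+2%:R) (n.+1%:R) (qint q k.+1) => N2 N1 Q Q_neq0 N2_neq0 N1_neq0 [E1 E2].
have D_neq0 : N2 ^+ 2 * N1 * Q != 0 by rewrite !mulf_neq0 ?expf_neq0.
by split; apply: (mulfI D_neq0); [rewrite E1|rewrite E2]; field; apply/and3P.
Qed.

(** Inclusion and exclusion over four corners: a second difference in (s, t) isolates a single pair
    of labels. *)
Lemma two_point_up (hn : (1 < n.+2)%N) a b :
  two_point hn mu a.+1 b.+1 =
  prob_up a.+1 b - prob_up a b - prob_up a.+1 b.+1 + prob_up a b.+1.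
Proof.
rewrite /two_point /prob_up !(big_mkcond (fun w : {perm 'I_n.+2} => _ && _)) /=.
rewrite -!sumrB -big_split /=; apply: eq_bigr => w _.
rewrite /label !eqSS (_ : Ordinal (ltnW hn) = i0); last exact: val_inj.
rewrite (_ : Ordinal hn = i1); last exact: val_inj.
rewrite !ltnS; case: (ltngtP (w i0) a) => _; case: (ltngtP (w i1) b) => _ /=; ring.
Qed.

Lemma two_point_down (hn : (1 < n.+2)%N) a b :
  two_point hn mu a.+1 b.+1 =
  prob_down b.+1 a - prob_down b a - prob_down b.+1 a.+1 + prob_down b a.+1.
Proof.
rewrite /two_point /prob_down !(big_mkcond (fun w : {perm 'I_n.+2} => _ && _)) /=.
rewrite -!sumrB -big_split /=; apply: eq_bigr => w _.
rewrite /label !eqSS (_ : Ordinal (ltnW hn) = i0); last exact: val_inj.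
rewrite (_ : Ordinal hn = i1); last exact: val_inj.
rewrite !ltnS; case: (ltngtP (w i0) a) => _; case: (ltngtP (w i1) b) => _ /=; ring.
Qed.

End TwoPoint.

(** * Comparison of the two-point probabilities at q and at 0 *)

Theorem theorem2p2 (R : realFieldType) (n : nat) (hn : (1 < n)%N) (q : R)
    (hq0 : 0 <= q) (hq1 : q < 1)
    (muq mu0 : {ffun {perm 'I_n} -> R})
    (hmuq : stationary q muq) (hmu0 : stationary 0 mu0) :
  (forall i j : nat, (1 <= j)%N -> (j < i)%N -> (i <= n)%N ->
     two_point hn muq i j =
       two_point hn mu0 i j
       + (i%:R - j%:R + 1)
         * (2 * j%:R * (n%:R - i%:R) + i%:R + j%:R - n%:R - 1)
         * (qint q (i - j + 1) - 1)
         / (n%:R ^+ 2 * (n%:R - 1) * qint q (i - j + 1))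
       - (i%:R - j%:R + 2) * (j%:R - 1) * (n%:R - i%:R)
         * (qint q (i - j + 2) - 1)
         / (n%:R ^+ 2 * (n%:R - 1) * qint q (i - j + 2))
       - j%:R * (i%:R - j%:R) * (n%:R - i%:R + 1)
         * (qint q (i - j) - 1)
         / (n%:R ^+ 2 * (n%:R - 1) * qint q (i - j)))
  /\
  (forall i j : nat, (1 <= i)%N -> (i < j)%N -> (j <= n)%N ->
     two_point hn muq i j =
       two_point hn mu0 i j
       - (j%:R - i%:R + 1)
         * (2 * i%:R * (n%:R - j%:R) + i%:R + j%:R - n%:R - 1)
         * q ^+ (j - i)
         / (n%:R ^+ 2 * (n%:R - 1) * qint q (j - i + 1))
       + (i%:R - 1) * (j%:R - i%:R + 2) * (n%:R - j%:R)
         * q ^+ (j - i + 1)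
         / (n%:R ^+ 2 * (n%:R - 1) * qint q (j - i + 2))
       + (if (i < j - 1)%N then
            i%:R * (j%:R - i%:R) * (n%:R - j%:R + 1) * q ^+ (j - i - 1)
            / (n%:R ^+ 2 * (n%:R - 1) * qint q (j - i))
          else 0)).
Proof.
case: n hn muq mu0 hmuq hmu0 => [|[|n]] // hn muq mu0 hmuq hmu0.
have n1E : n.+2%:R - 1 = n.+1%:R :> R by rewrite -natr1 addrK.
have n2 : n.+2%:R != 0 :> R by rewrite pnatr_eq0.
have n1 : n.+1%:R != 0 :> R by rewrite pnatr_eq0.
have qk_neq0 := qint_neq0 hq0 hq1.
have qint0 k : qint (0 : R) k.+1 = 1.
  by rewrite /qint big_ord_recl expr0 big1 ?addr0 // => i _; rewrite expr0n.
(* The formula at 0 is subtracted from the one at q. The power 0^k is 1 for k = 0, which is the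
   source of the exceptional case i = j - 1. *)
have up s t k (st : (s + k = t)%N) (le_t : (t <= n.+2)%N) :
    prob_up muq s t = prob_up mu0 s t
    + s%:R * (n.+2%:R - t%:R) * (k.+1%:R * (q ^+ k / qint q k.+1 - 0 ^+ k))
      / (n.+2%:R ^+ 2 * n.+1%:R).
  rewrite -st in le_t *.
  have [-> _] := prob_up_downE hq0 hq1 hmuq le_t.
  have [-> _] := prob_up_downE (lexx 0) (@ltr01 R) hmu0 le_t.
  by rewrite qint0 divr1; ring.
have down s t k (st : (s + k = t)%N) (le_t : (t <= n.+2)%N) :
    prob_down muq s t = prob_down mu0 s t
    + s%:R * (n.+2%:R - t%:R) * (k.+1%:R * ((qint q k.+1)^-1 - 1))
      / (n.+2%:R ^+ 2 * n.+1%:R).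
  rewrite -st in le_t *.
  have [_ ->] := prob_up_downE hq0 hq1 hmuq le_t.
  have [_ ->] := prob_up_downE (lexx 0) (@ltr01 R) hmu0 le_t.
  by rewrite qint0 divr1; ring.
split=> i j.
- case: j => // j _; case: i => // i lt_ji le_i.
  (* The four corners have gaps d, d + 1, d + 1 and d + 2, matching the three q-integers of the
     statement. *)
  have [d iE] : exists d, i = (j + d.+1)%N by exists (i - j.+1)%N; lia.
  have -> : (i.+1 - j.+1 + 1 = d.+2)%N by lia.
  have -> : (i.+1 - j.+1 + 2 = d.+3)%N by lia.
  have -> : (i.+1 - j.+1 = d.+1)%N by lia.
  rewrite !two_point_down (@down j.+1 i d) ?(@down j i d.+1) ?(@down j.+1 i.+1 d.+1)
    ?(@down j i.+1 d.+2); try lia.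
  rewrite n1E iE -addSn !natrD -!natr1.
  move: (qk_neq0 d) (qk_neq0 d.+1) (qk_neq0 d.+2) n1 n2; rewrite -!natr1.
  move: (qint q d.+1) (qint q d.+2) (qint q d.+3) => Q1 Q2 Q3 Q1n Q2n Q3n n1n n2n.
  by field; apply/and5P.
- case: i => // i _; case: j => // j lt_ij le_j.
  have [d jE] : exists d, j = (i + d.+1)%N by exists (j - i.+1)%N; lia.
  have -> : (j.+1 - i.+1 + 1 = d.+2)%N by lia.
  have -> : (j.+1 - i.+1 + 2 = d.+3)%N by lia.
  have -> : (j.+1 - i.+1 - 1 = d)%N by lia.
  have -> : (j.+1 - i.+1 = d.+1)%N by lia.
  have -> : (i.+1 < j.+1 - 1)%N = (0 < d)%N by lia.
  rewrite !two_point_up (@up i.+1 j d) ?(@up i j d.+1) ?(@up i.+1 j.+1 d.+1)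
    ?(@up i j.+1 d.+2); try lia.
  (* At d = 0 both q^d / [d + 1] and 0^d are 1, so the term 0^d absorbs the case distinction. *)
  have -> : (if (0 < d)%N then i.+1%:R * (j.+1%:R - i.+1%:R) * (n.+2%:R - j.+1%:R + 1)
      * q ^+ d / (n.+2%:R ^+ 2 * (n.+2%:R - 1) * qint q d.+1) else 0) =
      i.+1%:R * (j.+1%:R - i.+1%:R) * (n.+2%:R - j.+1%:R + 1)
      * (q ^+ d / qint q d.+1 - 0 ^+ d) / (n.+2%:R ^+ 2 * n.+1%:R).
    case: (posnP d) => [->|d_gt0].
      by rewrite /qint big_ord1 !expr0 divr1 subrr mulr0 mul0r.
    by rewrite n1E expr0n gtn_eqF // subr0 invfM; ring.
  rewrite n1E jE -addSn !natrD -!natr1 !exprS !mul0r.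
  (* The higher powers of 0 having vanished, 0^d and q^d can be treated as independent unknowns. *)
  move: (0 ^+ d) (q ^+ d) => z y.
  move: (qk_neq0 d) (qk_neq0 d.+1) (qk_neq0 d.+2) n1 n2; rewrite -!natr1.
  move: (qint q d.+1) (qint q d.+2) (qint q d.+3) => Q1 Q2 Q3 Q1n Q2n Q3n n1n n2n.
  by field; apply/and5P.
Qed.
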